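(* Every $3$-edge-connected graph $G$ satisfies $fn(G)\le 4$.
   Context: All graphs are finite. An orientation $(G,o)$ of a graph $G$ assigns to each edge one of its two directions. An orientation is strong if for every ordered pair of distinct vertices $u,v$ there is a directed $uv$-path. An edge $e$ is deletable in an orientation $(G,o)$ if the restriction of $o$ to $E(G)\setminus\{e\}$ is a strong orientation of $G-e$. For a $3$-edge-connected graph $G$, the Frank number $fn(G)$ is the minimum number $k$ such that $G$ admits $k$ orientations with the property that every edge of $G$ is deletable in at least one of them. *)

(* Defs.v *)
(* Finite multigraphs (parallel edges and loops allowed):
   vertex type V, edge type E, and ends e = the (ordered) pair of endpoints
   of edge e; the order is only a reference orientation. *)
From mathcomp Require Import all_boot.
Set Implicit Arguments. Unset Strict Implicit. Unset Printing Implicit Defensive.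

Section Graphs.
Variables (V E : finType) (ends : E -> V * V).

Definition orientation := E -> bool.

Definition otail (o : orientation) (e : E) : V :=
  if o e then (ends e).1 else (ends e).2.
Definition ohead (o : orientation) (e : E) : V :=
  if o e then (ends e).2 else (ends e).1.

Definition darc (S : {set E}) (o : orientation) : rel V :=
  fun x y => [exists e in S, (otail o e == x) && (ohead o e == y)].

Definition strong_on (S : {set E}) (o : orientation) : Prop :=
  forall u v : V, connect (darc S o) u v.

Definition strong (o : orientation) : Prop := strong_on [set: E] o.

Definition deletable (o : orientation) (e : E) : Prop :=
  strong_on ([set: E] :\ e) o.

Definition uarc (S : {set E}) : rel V :=
  fun x y => [exists e in S,
     (((ends e).1 == x) && ((ends e).2 == y)) ||
     (((ends e).1 == y) && ((ends e).2 == x))].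

Definition k_edge_connected (k : nat) : Prop :=
  forall F : {set E}, #|F| < k -> forall u v : V, connect (uarc (~: F)) u v.

Definition frank_family (k : nat) (os : 'I_k -> orientation) : Prop :=
  forall e : E, exists i : 'I_k, deletable (os i) e.

Definition frank_number_le (k : nat) : Prop :=
  exists k' : nat, k' <= k /\ exists os : 'I_k' -> orientation, frank_family os.

End Graphs.

(* Main.v *)
(* All chains are integer valued on edges. If f is a nowhere-zero circulation, g
   a circulation with |f| >= 1 + |g| everywhere, and |f e| < 2 + |g e|, then e is
   deletable in the orientation of f: otherwise some cut has e against all its
   other edges, at least two of them, so |f e| >= 2 + |g e|.

   Seymour's argument for the 6-flow theorem gives a chain x0 with even boundary
   and a circulation y0 such that each edge has x0 odd or y0 nonzero modulo 3.
   By rounding x0 / 2, y0 / 3 and then what is left of y0, one gets circulations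
   x with |x| <= 1 and y, y' with |y|, |y'| <= 2 lifting y0 modulo 3, and no edge
   has |y| = |y'| = 2. The orientations of 3y + x, 3y' - x, y' + 3x and y - 3x
   do the job: with g = y for the first, g = y' for the second and g = 0 for the
   last two, every edge satisfies the criterion for one of the four. *)
Require Import Defs.
From mathcomp Require Import all_boot.
From mathcomp Require Import all_order all_algebra zify.
Set Implicit Arguments. Unset Strict Implicit. Unset Printing Implicit Defensive.
Import Order.TTheory GRing.Theory Num.Theory.

Section Flows.
Local Open Scope ring_scope.
Variables (V E : finType) (ends : E -> V * V).

Notation src e := (ends e).1.
Notation tgt e := (ends e).2.

(** * Chains, cuts and paths *)

Definition chain_div (w : E -> int) (v : V) : int :=
  \sum_e w e * ((src e == v)%:R - (tgt e == v)%:R).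

Definition cut_sign (X : {set V}) (e : E) : int :=
  (src e \in X)%:R - (tgt e \in X)%:R.

Definition circulation (w : E -> int) := forall v, chain_div w v = 0.

Definition dtail (e : E) (d : bool) := if d then src e else tgt e.
Definition dhead (e : E) (d : bool) := if d then tgt e else src e.

(** [D e d] permits traversing [e], forwards when [d] is true and backwards otherwise, so [D] can
    encode a residual network. *)
Definition dstep (D : E -> bool -> bool) : rel V :=
  fun x y => [exists e, exists d, [&& D e d, dtail e d == x & dhead e d == y]].

Definition unit_along (D : E -> bool -> bool) (q : E -> int) :=
  forall e, [|| q e == 0, (q e == 1) && D e true | (q e == -1) && D e false].

Lemma sum_delta (X : {set V}) (x : V) :
  \sum_(v in X) ((x == v)%:R : int) = (x \in X)%:R.
Proof.
case: (boolP (x \in X)) => xX.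
  rewrite (bigD1 x) //= eqxx big1 ?addr0 // => v /andP[_].
  by rewrite eq_sym => /negPf ->.
by rewrite big1 // => v vX; case: eqP xX => // ->; rewrite vX.
Qed.

Lemma sum_div_cut (w : E -> int) (X : {set V}) :
  \sum_(v in X) chain_div w v = \sum_e w e * cut_sign X e.
Proof.
rewrite exchange_big /=; apply: eq_bigr => e _.
by rewrite -mulr_sumr sumrB !sum_delta.
Qed.

Lemma circulation_cut (w : E -> int) (X : {set V}) :
  circulation w -> \sum_e w e * cut_sign X e = 0.
Proof. by move=> w0; rewrite -sum_div_cut big1. Qed.

Lemma eq_div (w w' : E -> int) : w =1 w' -> chain_div w =1 chain_div w'.
Proof. by move=> h v; apply: eq_bigr => e _; rewrite h. Qed.

Lemma div0 v : chain_div (fun=> 0) v = 0.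
Proof. by rewrite /chain_div big1 // => e _; rewrite mul0r. Qed.

Lemma divD (w w' : E -> int) v :
  chain_div (fun e => w e + w' e) v = chain_div w v + chain_div w' v.
Proof. by rewrite -big_split; apply: eq_bigr => e _; rewrite /= mulrDl. Qed.

Lemma divZ (k : int) (w : E -> int) v :
  chain_div (fun e => k * w e) v = k * chain_div w v.
Proof. by rewrite mulr_sumr; apply: eq_bigr => e _; rewrite mulrA. Qed.

Lemma divN (w : E -> int) v : chain_div (fun e => - w e) v = - chain_div w v.
Proof.
by rewrite -mulN1r -divZ; apply: eq_div => e; rewrite mulN1r.
Qed.

Lemma divB (w w' : E -> int) v :
  chain_div (fun e => w e - w' e) v = chain_div w v - chain_div w' v.
Proof. by rewrite divD divN. Qed.

Lemma div_sum (I : finType) (w : I -> E -> int) v :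
  chain_div (fun e => \sum_i w i e) v = \sum_i chain_div (w i) v.
Proof. by rewrite exchange_big; apply: eq_bigr => e _; rewrite mulr_suml. Qed.

Lemma div_edge (e : E) v :
  chain_div (fun e' => (e' == e)%:R) v = (src e == v)%:R - (tgt e == v)%:R.
Proof.
rewrite /chain_div (bigD1 e) //= eqxx mul1r big1 ?addr0 // => e' /negPf ->.
by rewrite mul0r.
Qed.

(** The support clause carries the induction: since [x] is not on the rest of the path, the first
    edge still has value 0 there, and its new value is 1 or -1. *)
Lemma path_chain D x p :
  path (dstep D) x p -> uniq (x :: p) ->
  exists2 q, unit_along D q &
   (forall v, chain_div q v = (x == v)%:R - (last x p == v)%:R) /\
   (forall e, q e != 0 -> (src e \in x :: p) && (tgt e \in x :: p)).
Proof.
elim: p x => [|y p IH] x.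
  move=> _ _; exists (fun=> 0) => [e|]; first by rewrite eqxx.
  by split=> [v|e]; rewrite ?div0 ?subrr ?eqxx.
rewrite [path _ _ _]/= => /andP[/existsP[e /existsP[d /and3P[De /eqP te /eqP he]]] py].
rewrite [uniq _]/= => /andP[xNp uyp].
have [q qD [qdiv qsupp]] := IH y py uyp.
have qe0 : q e = 0.
  apply/eqP; apply: contraNT xNp => /qsupp /andP[se te'].
  by rewrite -te /dtail; case: (d).
exists (fun e' => q e' + (if d then 1 else -1) * (e' == e)%:R).
  move=> e'; have := qD e'; case: (eqVneq e' e) => [->|_].
    by rewrite qe0; case: (d) De => ->; rewrite !add0r.
  by rewrite mulr0 addr0.
split=> [v|e'].
  rewrite divD qdiv divZ div_edge [last _ (_ :: _)]/= -te -he /dtail /dhead.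
  by case: (d); lia.
case: (eqVneq e' e) => [-> _|_].
  by move: te he; rewrite /dtail /dhead; case: (d) => -> ->; rewrite !inE !eqxx ?orbT.
rewrite mulr0 addr0 => /qsupp /andP[h1 h2].
by rewrite [_ \in x :: _]inE h1 [tgt _ \in x :: _]inE h2 !orbT.
Qed.

Lemma reach_or_cut D x y :
  (exists2 q, unit_along D q &
     forall v, chain_div q v = (x == v)%:R - (y == v)%:R) \/
  (exists X : {set V}, [/\ x \in X, y \notin X &
     forall e d, D e d -> dtail e d \in X -> dhead e d \in X]).
Proof.
case: (boolP (connect (dstep D) x y)) => [/connectP[p pp ->]|nc].
  have [p' pp' up' _] := shortenP pp.
  by have [q qD [qdiv _]] := path_chain pp' up'; left; exists q.
right; exists [set v | connect (dstep D) x v]; split; rewrite ?inE //.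
move=> e d De; rewrite !inE => h; apply: (connect_trans h); apply: connect1.
by apply/existsP; exists e; apply/existsP; exists d; rewrite De !eqxx.
Qed.

(** * Rounding *)

(** If [w e] is not a multiple of [K], look for a cycle through [e] among such edges. If there is
    none, some cut has [e] as its only non-multiple, although the total of [w] over the cut is a sum
    of boundaries and hence a multiple. *)
Lemma round_or_cycle (K : nat) (w : E -> int) :
  (forall v, (K%:Z %| chain_div w v)%Z) ->
  (forall e, (K%:Z %| w e)%Z) \/
  exists z : E -> int, [/\ circulation z,
     exists e, z e != 0 &
     forall e, (z e == 0) || (`|z e| == 1) && ~~ (K%:Z %| w e)%Z].
Proof.
move=> wdiv.
case: (boolP [forall e, (K%:Z %| w e)%Z]) => [/forallP|]; first by left.
rewrite negb_forall => /existsP[e wNe]; right.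
pose D (e' : E) (d : bool) := (e' != e) && ~~ (K%:Z %| w e')%Z.
have [[q qD qdiv]|[X [tX sNX closed]]] := reach_or_cut D (tgt e) (src e).
  exists (fun e' => q e' + (e' == e)%:R); split.
  - by move=> v; rewrite divD qdiv div_edge; lia.
  - exists e; have := qD e; rewrite /D eqxx /= !andbF !orbF => /eqP ->.
    by rewrite add0r.
  - move=> e'; have := qD e'; rewrite /D; case: (eqVneq e' e) => [->|_] /=.
      by rewrite !andbF !orbF => /eqP ->; rewrite wNe.
    by rewrite addr0; lia.
exfalso.
have : (K%:Z %| \sum_(v in X) chain_div w v)%Z.
  by apply: rpred_sum => v _; apply: wdiv.
rewrite sum_div_cut (bigD1 e) //= rpredDr.
  by rewrite /cut_sign tX (negPf sNX) sub0r mulrN1 rpredN (negPf wNe).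
apply: rpred_sum => e' ne'.
case: (boolP (K%:Z %| w e')%Z) => [h|wN]; first exact: dvdz_mulr.
have := closed e' true; have := closed e' false.
rewrite /D ne' wN /dtail /dhead /cut_sign => /(_ isT) h1 /(_ isT) h2.
have -> : (src e' \in X) = (tgt e' \in X) by apply/idP/idP.
by rewrite subrr mulr0 dvdz0.
Qed.

(* Strictly concave between consecutive multiples of K: pushing along a cycle of
   non-multiples decreases the total gap in one of the two directions. *)
Definition residue_gap (K : nat) (a : int) : nat :=
  (`|(a %% K)%Z| * (K - `|(a %% K)%Z|))%N.

Lemma residue_gap_concave (K : nat) (a : int) : (0 < K)%N -> ~~ (K%:Z %| a)%Z ->
  (residue_gap K (a + 1) + residue_gap K (a - 1) + 2
    = 2 * residue_gap K a)%N.
Proof.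
move=> K0 Ka; rewrite /residue_gap.
have aE := divz_eq a K; set q := (a %/ K)%Z in aE.
have r0 : 0 <= (a %% K)%Z by rewrite modz_ge0 //; lia.
have rK : (a %% K)%Z < K by rewrite ltz_pmod.
have rN0 : (a %% K)%Z != 0 by apply: contra Ka => /eqP h; apply/dvdz_mod0P.
move: r0 rK rN0 aE; case: (a %% K)%Z => // r _ rK rN0 aE.
have -> : ((a - 1) %% K)%Z = (r.-1)%:Z.
  have -> : a - 1 = q * K + (r.-1)%:Z by lia.
  by rewrite modzMDl modz_small //; lia.
(* The residue of [a + 1] may wrap around to 0; this is harmless because r(K - r) vanishes at both 0
   and K. *)
case: (eqVneq r.+1 K) => [rE|rE].
  have -> : ((a + 1) %% K)%Z = 0.
    have -> : a + 1 = (q + 1) * K by lia.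
    exact: modzMl.
  by rewrite /=; nia.
have -> : ((a + 1) %% K)%Z = (r.+1)%:Z.
  have -> : a + 1 = q * K + (r.+1)%:Z by lia.
  by rewrite modzMDl modz_small //; lia.
rewrite !absz_nat.
case: r rK rN0 rE {aE} => // r rK _ rE.
have [m Km] : exists m, K = (r + 3 + m)%N by exists (K - r - 3)%N; lia.
rewrite Km /=; have -> : (r + 3 + m - r.+2 = m.+1)%N by lia.
have -> : (r + 3 + m - r = m + 3)%N by lia.
have -> : (r + 3 + m - r.+1 = m + 2)%N by lia.
nia.
Qed.

(** [a] lies strictly between two consecutive multiples of [K] and [a + z] does not pass them, so a
    multiple at distance less than [K] from [a + z] is one of these two. *)
Lemma rounding_step (K : nat) (a z s : int) : ~~ (K%:Z %| a)%Z -> `|z| = 1 ->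
  `|K%:Z * s - (a + z)| < K%:Z -> `|K%:Z * s - a| < K%:Z.
Proof.
move=> Ka z1 h.
have K0 : (0 < K)%N by lia.
have aE := divz_eq a K; set q := (a %/ K)%Z in aE.
have r0 : 0 <= (a %% K)%Z by rewrite modz_ge0 //; lia.
have rK : (a %% K)%Z < K by rewrite ltz_pmod.
have rN0 : (a %% K)%Z != 0 by apply: contra Ka => /eqP ?; apply/dvdz_mod0P.
set r := (a %% K)%Z in r0 rK rN0 aE.
have sE : K%:Z * s = K%:Z * (s - q) + q * K by lia.
have [u0|[u1|[u2|u3]]] : s - q = 0 \/ s - q = 1 \/ s - q >= 2 \/ s - q <= -1 by lia.
- by rewrite u0 in sE; lia.
- by rewrite u1 in sE; lia.
- have : K%:Z * (s - q) >= K%:Z * 2 by rewrite ler_wpM2l.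
  by lia.
- have : K%:Z * (s - q) <= K%:Z * -1 by rewrite ler_wpM2l.
  by lia.
Qed.

Lemma residue_gap_push (K : nat) (a z : int) : (0 < K)%N ->
  (z == 0) || (`|z| == 1) && ~~ (K%:Z %| a)%Z ->
  (residue_gap K (a + z) + residue_gap K (a - z) + (z != 0%R) * 2
    = 2 * residue_gap K a)%N.
Proof.
move=> K0 /orP[/eqP ->|/andP[z1 Ka]]; first by rewrite eqxx ?addr0 ?subr0; lia.
have [->|->] : z = 1 \/ z = -1 by lia.
  by rewrite -residue_gap_concave.
by rewrite -residue_gap_concave // opprK; congr (_ + _)%N; exact: addnC.
Qed.

(** [s] is [w / K] rounded up or down without changing the boundary. Induction on the total gap:
    pushing along circulations of non-multiples ends when all values are multiples of [K]. *)
Lemma rounding (K : nat) (w : E -> int) : (0 < K)%N ->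
  (forall v, (K%:Z %| chain_div w v)%Z) ->
  exists s : E -> int, (forall v, chain_div w v = K%:Z * chain_div s v) /\
    (forall e, `|K%:Z * s e - w e| < K%:Z).
Proof.
move=> K0.
have [m] := ubnP (\sum_e residue_gap K (w e))%N.
elim: m w => // m IH w wm wdiv.
case: (round_or_cycle wdiv) => [Kw|[z [zcirc [e0 ze0] zw]]].
  exists (fun e => (w e %/ K)%Z).
  have wE e : w e = K%:Z * (w e %/ K)%Z by rewrite mulrC divzK.
  split=> [v|e]; last by rewrite -wE; lia.
  by rewrite -divZ; apply: eq_div.
have gapE : (\sum_e residue_gap K (w e + z e) + \sum_e residue_gap K (w e - z e)
    + \sum_e (z e != 0%R) * 2 = 2 * \sum_e residue_gap K (w e))%N.
  rewrite -!big_split big_distrr; apply: eq_bigr => e _ /=.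
  exact: residue_gap_push.
have gap0 : (0 < \sum_e (z e != 0%R) * 2)%N.
  by rewrite (bigD1 e0) //= ze0.
(* The total gaps of [w + z] and [w - z] add up to less than twice that of [w], so one of the two is
   smaller. *)
have [z' [z'circ z'w z'm]] : exists z', [/\ circulation z',
    forall e, (z' e == 0) || (`|z' e| == 1) && ~~ (K%:Z %| w e)%Z
    & (\sum_e residue_gap K (w e + z' e) < m)%N].
  case: (ltnP (\sum_e residue_gap K (w e + z e)) m) => h; first by exists z.
  exists (fun e => - z e); split=> [v|e|]; first by rewrite divN zcirc oppr0.
    by rewrite oppr_eq0 normrN.
  by lia.
have [|s [sdiv sw]] := IH _ z'm.
  by move=> v; rewrite divD z'circ addr0.
exists s; split=> [v|e]; first by rewrite -sdiv divD z'circ addr0.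
case/orP: (z'w e) (sw e) => [/eqP ->|/andP[/eqP z1 Kw]]; first by rewrite addr0.
exact: rounding_step.
Qed.

(** * Deletable edges *)

Lemma norm_cut_sign X e : cut_sign X e = 0 \/ `|cut_sign X e| = 1.
Proof. by rewrite /cut_sign; do 2 case: (_ \in X); auto. Qed.

Lemma edge_connected_cut (k : nat) (X : {set V}) (u v : V) :
  k_edge_connected ends k -> u \in X -> v \notin X ->
  (k <= #|[set e | cut_sign X e != 0%R]|)%N.
Proof.
move=> kc uX vX; rewrite leqNgt; apply/negP => /kc /(_ u v).
move/connectP => [p pp vE].
suff: v \in X by rewrite (negPf vX).
rewrite {}vE {vX}; elim: p u uX pp => //= w p IH u uX /andP[/existsP[e]].
rewrite !inE negbK => /andP[/eqP c0 h] /IH; apply.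
move: c0 h uX; rewrite /cut_sign => c0.
by case/orP => /andP[/eqP <- /eqP <-]; move: c0; do 2 case: (_ \in X).
Qed.

Lemma deletable_of_flow (f g : E -> int) (e : E) :
  k_edge_connected ends 3 -> circulation f -> circulation g ->
  (forall e', `|f e'| >= 1 + `|g e'|) -> `|f e| < 2 + `|g e| ->
  deletable ends (fun e' => f e' > 0) e.
Proof.
move=> kc fc gc fg fe u v; set S := [set: E] :\ e; set o := fun _ => _.
apply/negPn/negP => nc.
pose X := [set x | connect (darc ends S o) u x].
have uX : u \in X by rewrite inE.
have vX : v \notin X by rewrite inE.
(* [X] is closed under all arcs but [e], so every other edge of its cut is directed into [X]. *)
have inw e' : e' != e -> f e' * cut_sign X e' = - (`|f e'| * `|cut_sign X e'|).
  move=> ne.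
  have : (otail ends o e' \in X) ==> (Defs.ohead ends o e' \in X).
    apply/implyP; rewrite !inE => h; apply: (connect_trans h); apply: connect1.
    by apply/existsP; exists e'; rewrite !inE ne !eqxx.
  have := fg e'; rewrite /otail /Defs.ohead /o /cut_sign.
  by case: (ltP 0 (f e')) => ?; do 2 case: (_ \in X) => //=; lia.
have [fX gX] := (circulation_cut X fc, circulation_cut X gc).
rewrite (bigD1 e) //= in fX; rewrite (bigD1 e) //= in gX.
have := edge_connected_cut kc uX vX.
rewrite (cardD1 e) -sum1_card inE; set n := (\sum_(_ in _) _)%N => cardX.
pose T := \sum_(e' | e' != e) `|cut_sign X e'|.
have T2 : 2 <= T.
  suff -> : T = n%:Z by lia.
  rewrite /T /n big_mkcond [X in X%:Z]big_mkcond /= (big_morph Posz PoszD (erefl _)).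
  apply: eq_bigr => e' _; rewrite !inE; case: (e' != e) => //=.
  by case: (norm_cut_sign X e') => [-> //|h]; rewrite h -normr_eq0 h.
have fE : f e * cut_sign X e = \sum_(e' | e' != e) `|f e'| * `|cut_sign X e'|.
  apply/eqP; rewrite -subr_eq0 -[X in _ == X]fX; apply/eqP; congr (_ + _).
  by rewrite -sumrN; apply: eq_bigr => e' /inw ->.
have gE : `|g e * cut_sign X e| <= \sum_(e' | e' != e) `|g e'| * `|cut_sign X e'|.
  have -> : g e * cut_sign X e = - \sum_(e' | e' != e) g e' * cut_sign X e'.
    by apply/eqP; rewrite -addr_eq0 gX.
  rewrite normrN; apply: le_trans (ler_norm_sum _ _ _) _.
  by apply: ler_sum => e' _; rewrite normrM.
have fT : T + \sum_(e' | e' != e) `|g e'| * `|cut_sign X e'|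
    <= \sum_(e' | e' != e) `|f e'| * `|cut_sign X e'|.
  rewrite -big_split; apply: ler_sum => e' _ /=.
  rewrite -[X in X + _]mul1r -mulrDl; apply: ler_wpM2r => //; exact: fg.
rewrite normrM in gE; case: (norm_cut_sign X e) => h.
  (* If [e] missed the cut, the flow over the other cut edges would total 0, against [T2]. *)
  by rewrite h in fE gE; lia.
have : `|f e * cut_sign X e| = `|f e| by rewrite normrM h mulr1.
by rewrite h mulr1 in gE; lia.
Qed.

(** * The 6-flow theorem *)

Definition inside (U : {set V}) (e : E) := (src e \in U) && (tgt e \in U).

Definition cut_in (W X : {set V}) := [set e | inside W e & cut_sign X e != 0].

Lemma unit_path_cut (q : E -> int) (a b : V) (X : {set V}) :
  (forall v, chain_div q v = (a == v)%:R - (b == v)%:R) ->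
  \sum_e q e * cut_sign X e = (a \in X)%:R - (b \in X)%:R.
Proof.
move=> qdiv; rewrite -sum_div_cut (eq_bigr _ (fun v _ => qdiv v)).
by rewrite sumrB !sum_delta.
Qed.

(** Two edge-disjoint paths in the form of a flow of value 2, obtained by augmenting a first path
    once. All values stay in {-1, 0, 1}, so they are odd on the support. *)
Lemma two_paths (W : {set V}) (a b : V) :
  (forall (X : {set V}) x y, x \in W -> y \in W -> x \in X -> y \notin X ->
     (1 < #|cut_in W X|)%N) ->
  a \in W -> b \in W ->
  exists g : E -> int, (forall e, g e != 0 -> odd `|g e|%N && inside W e) /\
    (forall v, chain_div g v = 2 * ((a == v)%:R - (b == v)%:R)).
Proof.
move=> conn2 aW bW.
have [[P PD Pdiv]|[X [aX bX closed]]] := reach_or_cut (fun e _ => inside W e) a b; last first.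
  have /card_gt1P[e [_ [+ _ _]]] := conn2 X a b aW bW aX bX.
  rewrite inE => /andP[eW]; have := closed e true eW; have := closed e false eW.
  rewrite /dtail /dhead /cut_sign /=.
  by case: (src e \in X); case: (tgt e \in X) => // h1 h2; [move: h2 | move: h1] => /(_ isT).
(* Residual graph of the path P: a set closed under D would be left by at least
   two edges, each of them carrying one unit of P outwards. *)
pose D e d := inside W e && (if d then P e <= 0 else 0 <= P e).
have [[Q QD Qdiv]|[X [aX bX closed]]] := reach_or_cut D a b.
  exists (fun e => P e + Q e); split=> [e|v]; last by rewrite divD Pdiv Qdiv; lia.
  by have := PD e; have := QD e; rewrite /D; case: (inside W e); lia.
exfalso.
have out e : e \in cut_in W X -> P e * cut_sign X e = 1.
  rewrite inE => /andP[eW]; have := closed e true; have := closed e false.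
  have := PD e; rewrite /D eW /dtail /dhead /cut_sign /=.
  by do 2 case: (_ \in X); lia.
have /card_gt1P[e1 [e2 [c1 c2 ne]]] := conn2 X a b aW bW aX bX.
have := unit_path_cut X Pdiv; rewrite aX (negPf bX).
rewrite (bigD1 e1) //= (bigD1 e2) 1?eq_sym //= out // out //.
set S := \sum_(_ | _) _; suff : 0 <= S by rewrite /S; lia.
apply: sumr_ge0 => e _; case: (boolP (e \in cut_in W X)) => [/out -> //|].
rewrite inE negb_and negbK => /orP[eW|/eqP ->]; last by rewrite mulr0.
by have := PD e; rewrite (negPf eW) !andbF !orbF => /eqP ->; rewrite mul0r.
Qed.

(** Connection by a chain instead of a path: transitivity is then mere addition, and closing up with
    an edge gives a circulation. *)
Definition linked (T : pred E) (a b : V) := exists q : E -> int,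
  (forall v, chain_div q v = (a == v)%:R - (b == v)%:R) /\
  (forall e, q e != 0 -> T e).

Lemma linked_refl T a : linked T a a.
Proof. by exists (fun=> 0); split=> [v|e]; rewrite ?div0 ?subrr ?eqxx. Qed.

Lemma linked_sym T a b : linked T a b -> linked T b a.
Proof.
move=> [q [qdiv qT]]; exists (fun e => - q e); split=> [v|e].
  by rewrite divN qdiv opprB.
by rewrite oppr_eq0; apply: qT.
Qed.

Lemma linked_trans T a b c : linked T a b -> linked T b c -> linked T a c.
Proof.
move=> [q [qdiv qT]] [r [rdiv rT]]; exists (fun e => q e + r e); split=> [v|e].
  by rewrite divD qdiv rdiv; lia.
case: (eqVneq (q e) 0) => [-> |/qT //]; rewrite add0r; apply: rT.
Qed.

Lemma linked_sub (T T' : pred E) a b : subpred T T' -> linked T a b -> linked T' a b.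
Proof. by move=> TT' [q [qdiv qT]]; exists q; split=> // e /qT /TT'. Qed.

Lemma linked_edge (T : pred E) e : T e -> linked T (src e) (tgt e).
Proof.
move=> Te; exists (fun e' => (e' == e)%:R); split=> [v|e']; first exact: div_edge.
by case: (eqVneq e' e) => [->|].
Qed.

Lemma linked_circulation T (e : E) : linked T (src e) (tgt e) ->
  exists z : E -> int, [/\ circulation z, (forall e', z e' != 0 -> (e' == e) || T e')
    & ~~ T e -> z e = 1].
Proof.
move=> [q [qdiv qT]]; exists (fun e' => (e' == e)%:R - q e'); split=> [v|e'|].
- by rewrite divB div_edge qdiv; lia.
- by case: (e' == e) => //=; rewrite sub0r oppr_eq0; apply: qT.
- by rewrite eqxx => Te; rewrite (_ : q e = 0) ?subr0 //; apply/eqP/(contraNT _ Te)/qT.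
Qed.

(** [R] is the component of [a] in the support of [g], and [h] is the part of [g] on it. It contains
    [b], since otherwise the boundary of [g] would sum to 2 over [R] instead of 0. *)
Lemma odd_component (g : E -> int) (W : {set V}) (a b : V) :
  (forall e, g e != 0 -> odd `|g e|%N && inside W e) -> a \in W ->
  (forall v, chain_div g v = 2 * ((a == v)%:R - (b == v)%:R)) ->
  exists (R : {set V}) (h : E -> int),
   [/\ a \in R, b \in R & R \subset W] /\
   [/\ forall e, h e != 0 -> odd `|h e|%N && inside R e,
       forall v, (2 %| chain_div h v)%Z &
       forall r, r \in R -> linked (fun e => h e != 0) a r].
Proof.
move=> gW aW gdiv.
pose D (e : E) (d : bool) := g e != 0.
pose R := [set v | connect (dstep D) a v].
have aR : a \in R by rewrite inE.
have stepP (x y : V) : dstep D x y -> exists2 e, g e != 0 &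
    (x = src e /\ y = tgt e) \/ (x = tgt e /\ y = src e).
  move=> /existsP[e /existsP[d /and3P[De /eqP <- /eqP <-]]]; exists e => //.
  by rewrite /dtail /dhead; case: d De; auto.
have closedR e : g e != 0 -> (src e \in R) = (tgt e \in R).
  move=> ge; apply/idP/idP; rewrite !inE => h; apply: (connect_trans h); apply: connect1;
    apply/existsP; exists e; apply/existsP.
    by exists true; rewrite /D ge !eqxx.
  by exists false; rewrite /D ge !eqxx.
have closed_step (X : {set V}) : (forall e, g e != 0 -> (src e \in X) = (tgt e \in X)) ->
    a \in X -> R \subset X.
  move=> cX aX; apply/subsetP => r; rewrite inE => /closed_connect <- //.
  by move=> x y /stepP[e /cX h [[-> ->]|[-> ->]]]; rewrite h.
pose h e := if src e \in R then g e else 0.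
have hg e : h e != 0 -> [/\ g e != 0, src e \in R & tgt e \in R].
  by rewrite /h; case: ifP => [sR ge|]; rewrite ?eqxx // -closedR.
exists R, h; split; split=> //.
- apply/negPn/negP => bR.
  have : \sum_(v in R) chain_div g v = 2.
    rewrite (eq_bigr _ (fun v _ => gdiv v)) -mulr_sumr sumrB !sum_delta.
    by rewrite aR (negPf bR).
  rewrite sum_div_cut big1 // => e _; rewrite /cut_sign.
  by case: (eqVneq (g e) 0) => [->|/closedR ->]; rewrite ?mul0r ?subrr ?mulr0.
- by apply: closed_step => // e /gW /andP[_ /andP[-> ->]].
- move=> e he; have [ge sR tR] := hg e he.
  by rewrite /inside sR tR; move: he; rewrite /h sR => /gW /andP[->].
- move=> v; suff -> : chain_div h v = (v \in R)%:R * chain_div g v.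
    by rewrite gdiv mulrCA dvdz_mulr.
  rewrite mulr_sumr; apply: eq_bigr => e _; rewrite mulrA /h.
  case: (eqVneq (g e) 0) => [->|/closedR]; first by rewrite if_same !mulr0 !mul0r.
  case: (boolP (src e \in R)) => sR tR; case: (boolP (v \in R)) => vR;
    rewrite ?mul1r ?mul0r //.
  + have /negPf -> : src e != v by apply: contraNneq vR => <-.
    have /negPf -> : tgt e != v by apply: contraNneq vR => <-; rewrite -tR.
    by rewrite mulr0.
  + have /negPf -> : src e != v by apply: contraNneq sR => ->.
    have /negPf -> : tgt e != v by apply: contraTneq vR => <-; rewrite -tR.
    by rewrite mulr0.
- move=> r rR.
  have [[q qD qdiv]|[X [aX rX closed]]] := reach_or_cut (fun e _ => h e != 0) a r.
    exists q; split=> // e; have := qD e; lia.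
  exfalso; have /subsetP/(_ r rR) : R \subset R :&: X; last by rewrite in_setI (negPf rX) andbF.
  apply: closed_step; last by rewrite in_setI aR.
  move=> e ge; rewrite !in_setI (closedR _ ge); case: (boolP (tgt e \in R)) => //= tR.
  have he : h e != 0 by rewrite /h closedR ?tR.
  have := closed e true he; have := closed e false he.
  by rewrite /dtail /dhead => h1 h2; apply/idP/idP.
Qed.

Lemma two_connected_piece (U : {set V}) : U != setT ->
  exists W : {set V}, [/\ W != set0, W \subset ~: U, (#|cut_in (~: U) W| <= 1)%N &
    forall (X : {set V}) x y, x \in W -> y \in W -> x \in X -> y \notin X ->
      (1 < #|cut_in W X|)%N].
Proof.
move=> UT.
(* A minimal set with at most one edge to the rest of ~: U: a cut of size at most
   one in it would leave a side satisfying P again. *)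
pose P (W : {set V}) := [&& W != set0, W \subset ~: U & (#|cut_in (~: U) W| <= 1)%N].
have P0 : P (~: U).
  rewrite /P subxx -setCT (inj_eq (@setC_inj _)) UT (_ : cut_in _ _ = set0) ?cards0 //.
  apply/setP => e; rewrite !inE /inside /cut_sign; case: (src e \in _) => //.
  by case: (tgt e \in _).
have [W /minsetP[/and3P[W0 WU WE] Wmin] _] := minset_exists P0.
exists W; split=> // X x y xW yW xX yX; rewrite ltnNge; apply/negP => XE.
have notP (Y : {set V}) z : Y \subset W -> z \in W -> z \notin Y -> Y != set0 ->
    (1 < #|cut_in (~: U) Y|)%N.
  move=> YW zW zY Y0; rewrite ltnNge; apply: contra zY => YE.
  by rewrite (Wmin Y) // /P Y0 YE (subset_trans YW WU).
have h1 : (1 < #|cut_in (~: U) (W :&: X)|)%N.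
  apply: (notP _ y) => //; first exact: subsetIl; first by rewrite inE (negPf yX) andbF.
  by apply/set0Pn; exists x; rewrite inE xW.
have h2 : (1 < #|cut_in (~: U) (W :\: X)|)%N.
  apply: (notP _ x) => //; first exact: subsetDl; first by rewrite inE xX.
  by apply/set0Pn; exists y; rewrite inE yW yX.
(* Each of the two sides of [W] has at least two boundary edges in [~: U], at most one of them
   inside [W], so each has an edge leaving [W]. Only one edge leaves [W] within [~: U], and it would
   need an end in both sides. *)
have step (Y : {set V}) : Y \subset W -> (1 < #|cut_in (~: U) Y|)%N ->
    cut_in (~: U) Y \subset cut_in W X :|: cut_in (~: U) W ->
    exists2 e, e \in cut_in (~: U) Y & e \in cut_in (~: U) W.
  move=> YW Y1 Ysub; apply/exists_inP; apply: contraLR Y1.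
  rewrite negb_exists_in -leqNgt => /forall_inP nW; apply: leq_trans XE.
  apply: subset_leq_card; apply/subsetP => e eY.
  by have := subsetP Ysub e eY; rewrite inE (negPf (nW e eY)) orbF.
have WinU v : v \in W -> v \in ~: U by apply: (subsetP WU).
have [|| e1 e1Y e1W] := step _ _ h1; first exact: subsetIl.
  apply/subsetP => e; rewrite !inE /inside /cut_sign !inE.
  by do 2 case: (_ \in W); do 2 case: (_ \in X); do 2 case: (_ \in U).
have [|| e2 e2Y e2W] := step _ _ h2; first exact: subsetDl.
  apply/subsetP => e; rewrite !inE /inside /cut_sign !inE.
  by do 2 case: (_ \in W); do 2 case: (_ \in X); do 2 case: (_ \in U).
have e12 : e1 = e2 by apply: (card_le1_eqP WE).
move: e1Y e2Y e1W; rewrite -e12 !inE /inside /cut_sign !inE.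
by do 2 case: (_ \in W); do 2 case: (_ \in X); do 2 case: (_ \in U).
Qed.

(* The offset p is there for the induction: the edges outside U are settled first,
   by circulations that also run through U. *)
Definition six_flow_on (U : {set V}) (x : E -> int) :=
  [/\ forall e, x e != 0 -> inside U e,
      forall v, (2 %| chain_div x v)%Z,
      forall a b, a \in U -> b \in U -> linked (inside U) a b &
      forall p : E -> int, exists q : E -> int,
        [/\ circulation q, forall e, q e != 0 -> inside U e &
            forall e, inside U e -> odd `|x e|%N || ~~ (3 %| p e + q e)%Z]].

Lemma six_flow_on_vertex (v0 : V) : six_flow_on [set v0] (fun=> 0).
Proof.
split=> [e|v|a b|p]; rewrite ?eqxx ?div0 ?inE //.
  by move=> /eqP -> /eqP ->; apply: linked_refl.
(* Only loops lie inside a single vertex, and any chain on loops is a circulation. *)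
exists (fun e => if inside [set v0] e then 1 - p e else 0); split.
- move=> v; apply: big1 => e _; rewrite /inside !inE.
  by case: andP => [[/eqP -> /eqP ->]|]; rewrite ?subrr ?mulr0 ?mul0r.
- by move=> e; case: ifP; rewrite ?eqxx.
- by move=> e ->; lia.
Qed.

Lemma avoid_mod3 (p q z : int) : `|z| = 1 ->
  exists t : int, ~~ (3 %| p + t * z)%Z && ~~ (3 %| q + t)%Z.
Proof.
move=> z1.
have : ~~ (3 %| p + 0 * z)%Z && ~~ (3 %| q + 0)%Z \/
       ~~ (3 %| p + 1 * z)%Z && ~~ (3 %| q + 1)%Z \/
       ~~ (3 %| p + -1 * z)%Z && ~~ (3 %| q + -1)%Z by lia.
by case=> [|[]]; eauto.
Qed.

(** At least three edges leave [W] and at most one of them ends in the rest of [~: U], so two end in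
    [U]. *)
Lemma two_edges_to_piece (U W : {set V}) :
  k_edge_connected ends 3 -> U != set0 -> W != set0 -> W \subset ~: U ->
  (#|cut_in (~: U) W| <= 1)%N ->
  exists e1 e2, [/\ e1 != e2, cut_sign U e1 != 0 /\ cut_sign W e1 != 0
                   & cut_sign U e2 != 0 /\ cut_sign W e2 != 0].
Proof.
move=> kc /set0Pn[u uU] /set0Pn[w wW] /subsetP WU WE.
have uW : u \notin W by apply: contraL uU => /WU; rewrite inE.
have cW := edge_connected_cut kc wW uW.
suff /card_gt1P[e1 [e2 []]] :
    (1 < #|[set e | cut_sign U e != 0 & cut_sign W e != 0]|)%N.
  by rewrite !inE => /andP[? ?] /andP[? ?] ?; exists e1, e2.
rewrite -ltnS -(addn1 #|_|); apply: leq_trans cW _.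
apply: leq_trans (leq_add (leqnn _) WE); apply: leq_trans (leq_card_setU _ _).
apply: subset_leq_card; apply/subsetP => e.
have := WU (src e); have := WU (tgt e).
rewrite !inE /inside /cut_sign !inE.
by do 2 case: (_ \in W); do 2 case: (_ \in U) => //=; auto.
Qed.

(** Adding [h] makes the chain odd on the support of [h]. The other new edges need a value nonzero
    modulo 3: those outside [T] other than [e2] are set one by one by fundamental circulations, then
    [e1] and [e2] together. *)
Lemma six_flow_on_extend (U : {set V}) (x : E -> int) :
  k_edge_connected ends 3 -> U != set0 -> U != setT -> six_flow_on U x ->
  exists (U' : {set V}) (x' : E -> int), U \proper U' /\ six_flow_on U' x'.
Proof.
move=> kc U0 UT [xU xdiv linkU fixU].
have [W [W0 WU WE conn2]] := two_connected_piece UT.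
have [e1 [e2 [ne [cU1 cW1] [cU2 cW2]]]] := two_edges_to_piece kc U0 W0 WU WE.
have disjW v : v \in W -> v \notin U by move/(subsetP WU); rewrite inE.
pose wend e := if src e \in W then src e else tgt e.
pose uend e := if src e \in W then tgt e else src e.
have endsP e : cut_sign U e != 0 -> cut_sign W e != 0 -> wend e \in W /\ uend e \in U.
  have := disjW (src e); have := disjW (tgt e).
  rewrite /wend /uend /cut_sign; case: (boolP (src e \in W)) => sW; case: (boolP (tgt e \in W)) => tW;
  by case: (boolP (src e \in U)) => sU; case: (boolP (tgt e \in U)) => tU //; auto.
have [w1W u1U] := endsP e1 cU1 cW1; have [w2W u2U] := endsP e2 cU2 cW2.
have [g [gW gdiv]] := two_paths conn2 w1W w2W.
have [R [h [[w1R w2R RW] [hR hdiv linkR]]]] := odd_component gW w1W gdiv.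
have disjR v : v \in R -> v \notin U by move/(subsetP RW)/disjW.
pose U' := U :|: R.
have subU e : inside U e -> inside U' e.
  by rewrite /inside !inE => /andP[-> ->].
have subR e : inside R e -> inside U' e.
  by rewrite /inside !inE => /andP[-> ->]; rewrite !orbT.
have subE e : wend e \in R -> uend e \in U -> inside U' e.
  by rewrite /inside !inE /wend /uend; case: ifP => _ -> ->; rewrite !orbT.
have notU e : wend e \in R -> ~~ inside U e.
  rewrite /inside /wend; case: ifP => _ /disjR /negPf ->; rewrite ?andbF //.
have notR e : uend e \in U -> ~~ inside R e.
  move=> eU; apply: contraL eU => /andP[sR tR].
  by rewrite /uend; case: ifP => _; apply: disjR.
(* [T] connects [U'], and [e1] is its only edge between [U] and [R]; the fundamental circulation of
   [e2] must therefore return through [e1]. *)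
pose T e := [|| inside U e, h e != 0 | e == e1].
have TU' e : T e -> inside U' e.
  by case/or3P => [/subU //|/hR /andP[_ /subR] //|/eqP ->]; apply: subE.
have hU e : inside U e -> h e = 0.
  move=> /andP[sU _]; apply/eqP; apply: contraTT sU => /hR /andP[_ /andP[/disjR //]].
have linkT a b : a \in U' -> b \in U' -> linked T a b.
  suff H c : c \in U' -> linked T (wend e1) c.
    by move=> /H aT /H; apply: linked_trans; apply: linked_sym.
  rewrite inE => /orP[cU|cR]; last first.
    by apply: linked_sub (linkR _ cR) => e he; rewrite /T he orbT.
  apply: (@linked_trans _ _ (uend e1)); last first.
    by apply: linked_sub (linkU _ _ u1U cU) => e he; rewrite /T he.
  have Te1 : T e1 by rewrite /T eqxx !orbT.
  rewrite /wend /uend; case: ifP => _; last apply: linked_sym; exact: linked_edge.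
have Te2 : ~~ T e2.
  rewrite /T negb_or notU // negb_or negbK (eq_sym e2) ne andbT /=.
  by apply: contraNT (notR _ u2U) => /hR /andP[].
exists U', (fun e => x e + h e); split.
  apply/properP; split; first exact: subsetUl.
  by exists (wend e1); [rewrite inE w1R orbT | apply: disjR].
split.
- move=> e; case: (eqVneq (x e) 0) => [->|/xU /subU //].
  by rewrite add0r => /hR /andP[_ /subR].
- by move=> v; rewrite divD rpredD.
- by move=> a b aU bU; apply: linked_sub (linkT _ _ aU bU).
move=> p.
have /fin_all_exists[z zP] e : exists z : E -> int, [/\ circulation z,
    forall e', z e' != 0 -> (e' == e) || T e' & inside U' e -> ~~ T e -> z e = 1].
  case: (boolP (inside U' e)) => [/andP[sU tU]|_].
    by have [z [? ? ?]] := linked_circulation (linkT _ _ sU tU); exists z.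
  by exists (fun=> 0); split=> [v|e'|//]; rewrite ?div0 ?eqxx.
pose N e := [&& inside U' e, ~~ T e & e != e2].
(* Circulations of different edges overlap only in [T], so the coefficient [1 - p e] makes [p + q1]
   equal to 1 on every edge of [N]. *)
pose q1 e' := \sum_e (if N e then 1 - p e else 0) * z e e'.
have q1circ : circulation q1.
  by move=> v; rewrite div_sum big1 // => e _; rewrite divZ; have [-> _ _] := zP e; rewrite mulr0.
have q1U e' : q1 e' != 0 -> inside U' e'.
  apply: contraNT => e'U; apply/eqP; apply: big1 => e _.
  case: ifP => [/and3P[eU eT _]|]; last by rewrite mul0r.
  have [_ zT _] := zP e; case: (eqVneq (z e e') 0) => [->|/zT]; first by rewrite mulr0.
  by case/orP => [/eqP ee|/TU' e'U']; [rewrite ee eU in e'U | rewrite e'U' in e'U].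
have q1N e' : N e' -> q1 e' = 1 - p e'.
  move=> Ne'; have /and3P[e'U e'T _] := Ne'.
  rewrite /q1 (bigD1 e') //= Ne' big1 ?addr0 => [|e ee].
    by have [_ _ ->] := zP e'; rewrite ?mulr1.
  have [_ zT _] := zP e; case: (eqVneq (z e e') 0) => [->|/zT]; first by rewrite mulr0.
  by rewrite eq_sym (negPf ee) (negPf e'T).
have [z2circ z2T z2e2] := zP e2.
have e2U' : inside U' e2 by apply: subE.
have z2E2 := z2e2 e2U' Te2.
have z2E1 : `|z e2 e1| = 1.
  have := circulation_cut U z2circ.
  rewrite (bigD1 e2) //= (bigD1 e1) //= big1 => [|e /andP[ee2 ee1]].
    have c1 e : cut_sign U e != 0 -> `|cut_sign U e| = 1.
      by case: (norm_cut_sign U e) => // ->; rewrite eqxx.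
    rewrite z2E2 mul1r addr0 addrC => /eqP; rewrite addr_eq0 => /eqP/(congr1 Num.norm).
    by rewrite normrM normrN !c1 // mulr1.
  case: (eqVneq (z e2 e) 0) => [->|/z2T]; first by rewrite mul0r.
  rewrite (negPf ee2) /T (negPf ee1) orbF /= /cut_sign => /orP[/andP[-> ->]|]; first by rewrite subrr mulr0.
  by move=> /hR /andP[_ /andP[/disjR /negPf -> /disjR /negPf ->]]; rewrite subrr mulr0.
(* Each of e1 and e2 excludes a single residue of t. *)
have [t /andP[t1 t2]] := avoid_mod3 (p e1 + q1 e1) (p e2 + q1 e2) z2E1.
(* Everything added so far enters as the offset; [q2] repairs the edges inside [U] and vanishes on
   the new ones. *)
have [q2 [q2circ q2U q2P]] := fixU (fun e => p e + q1 e + t * z e2 e).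
exists (fun e => q1 e + t * z e2 e + q2 e); split.
- by move=> v; rewrite !divD divZ q1circ z2circ q2circ mulr0.
- move=> e; case: (eqVneq (q1 e) 0) => [->|/q1U //].
  case: (eqVneq (z e2 e) 0) => [->|/z2T /orP[/eqP -> //|/TU' //]].
  by rewrite mulr0 !add0r => /q2U /subU.
move=> e eU'; case: (boolP (inside U e)) => eU.
  by have := q2P e eU; rewrite hU // addr0 !addrA.
have -> : x e = 0 by apply/eqP; apply: contraNT eU => /xU.
have -> : q2 e = 0 by apply/eqP; apply: contraNT eU => /q2U.
rewrite add0r addr0 addrA.
case: (eqVneq (h e) 0) => [he|/hR /andP[-> //]].
case: (eqVneq e e1) => [->|ee1]; first by rewrite t1 orbT.
case: (eqVneq e e2) => [->|ee2]; first by rewrite z2E2 mulr1 t2 orbT.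
have eT : ~~ T e by rewrite /T (negPf eU) he eqxx (negPf ee1).
have -> : z e2 e = 0.
  by apply/eqP; apply: contraNT eT => /z2T; rewrite (negPf ee2).
by rewrite q1N ?/N ?eU' ?eT ?ee2 // mulr0 addr0 addrC subrK orbT.
Qed.

Lemma six_flow : k_edge_connected ends 3 ->
  exists x y : E -> int, [/\ forall v, (2 %| chain_div x v)%Z, circulation y &
    forall e, odd `|x e|%N || ~~ (3 %| y e)%Z].
Proof.
move=> kc; case: (pickP (mem [set: V])) => [v0 _|V0]; last first.
  exists (fun=> 1), (fun=> 0); split=> [v|v|//]; last by rewrite div0.
  by have := V0 v; rewrite !inE.
suff [x [_ xdiv _ /(_ (fun=> 0))[q [qcirc _ qP]]]] : exists x, six_flow_on setT x.
  exists x, q; split=> // e; have := qP e; rewrite add0r; apply.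
  by rewrite /inside !inE.
suff H n (U : {set V}) x : (#|~: U| < n)%N -> U != set0 -> six_flow_on U x ->
    exists x, six_flow_on setT x.
  apply: (H _ _ _ (ltnSn _) _ (six_flow_on_vertex v0)).
  by apply/set0Pn; exists v0; rewrite inE.
elim: n U x => // n IH U x Un U0 Ux.
case: (eqVneq U setT) => [UT|UT]; first by exists x; rewrite -UT.
have [U' [x' [UU' U'x']]] := six_flow_on_extend kc U0 UT Ux.
apply: (IH U' x') => //.
  by rewrite -ltnS; apply: leq_trans Un; rewrite ltnS; apply: proper_card; rewrite properC.
by case/properP: UU' => _ [v vU' _]; apply/set0Pn; exists v.
Qed.

(** * Four orientations *)

Lemma three_flows : k_edge_connected ends 3 ->
  exists x y y' : E -> int, [/\ circulation x, circulation y, circulation y' &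
    forall e, [/\ `|x e| <= 1, `|y e| <= 2 & `|y' e| <= 2] /\
      [/\ (x e != 0) || (y e != 0), (3 %| y e - y' e)%Z & `|y e| + `|y' e| <= 3]].
Proof.
move=> /six_flow [x0 [y0 [x0div y0circ xy0]]].
have [r [rdiv rE]] := @rounding 2 x0 isT x0div.
have [|s [sdiv sE]] := @rounding 3 y0 isT.
  by move=> v; rewrite y0circ dvdz0.
have scirc : circulation s by move=> v; have := sdiv v; rewrite y0circ; lia.
(* With [y = y0 - 3 s] one has [y0 - s = 2 s + y], so [s' - s] is [y / 2] rounded. Then
   [y' = y - 3 (s' - s)] sends 0 to 0, 1 to 1 or -2, and 2 to -1, and likewise with signs
   reversed. *)
have [|s' [s'div s'E]] := @rounding 2 (fun e => y0 e - s e) isT.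
  by move=> v; rewrite divB y0circ scirc.
have s'circ : circulation s'.
  by move=> v; have := s'div v; rewrite divB y0circ scirc; lia.
exists (fun e => x0 e - 2 * r e), (fun e => y0 e - 3 * s e), (fun e => y0 e - 3 * s' e).
split=> [v|v|v|e].
- by rewrite divB divZ rdiv subrr.
- by rewrite divB divZ y0circ scirc.
- by rewrite divB divZ y0circ s'circ.
move: (rE e) (sE e) (s'E e) (xy0 e) => *; do 2 split; lia.
Qed.

Lemma frank_number_of_flows (x y y' : E -> int) : k_edge_connected ends 3 ->
  circulation x -> circulation y -> circulation y' ->
  (forall e, [/\ `|x e| <= 1, `|y e| <= 2 & `|y' e| <= 2] /\
    [/\ (x e != 0) || (y e != 0), (3 %| y e - y' e)%Z & `|y e| + `|y' e| <= 3]) ->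
  frank_number_le ends 4.
Proof.
move=> kc xc yc y'c xy.
pose f (i : 'I_4) : E -> int := nth (fun=> 0)
  [:: fun e => 3 * y e + x e; fun e => 3 * y' e - x e;
      fun e => y' e + 3 * x e; fun e => y e - 3 * x e] i.
have zc : circulation (fun=> 0) by move=> v; apply: div0.
exists 4; split=> //; exists (fun i e => 0 < f i e) => e.
have [[x1 y2 y'2] [xy0 yy' yy'3]] := xy e.
(* If [x = 0], then [y] or [y'] is 1 or -1 and one of the last two holds. If [x] is 1 or -1, the
   first holds for [y] in {0, -x}, the second for [y' = x], the third for [y' = -2x] and the fourth
   for [y = 2x]; these exhaust the possible pairs. *)
have : [|| `|3 * y e + x e| < 2 + `|y e|, `|3 * y' e - x e| < 2 + `|y' e|,
   `|y' e + 3 * x e| < 2 | `|y e - 3 * x e| < 2] by lia.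
case/or4P => h.
- exists (inord 0); rewrite /f inordK //=.
  apply: (deletable_of_flow kc _ yc _ h) => [v|e']; first by rewrite divD divZ yc xc.
  by have [[? ? ?] [? ? ?]] := xy e'; lia.
- exists (inord 1); rewrite /f inordK //=.
  apply: (deletable_of_flow kc _ y'c _ h) => [v|e']; first by rewrite divB divZ y'c xc.
  by have [[? ? ?] [? ? ?]] := xy e'; lia.
- exists (inord 2); rewrite /f inordK //=.
  apply: (deletable_of_flow kc _ zc); last by rewrite normr0 addr0.
    by move=> v; rewrite divD divZ y'c xc.
  by move=> e'; have [[? ? ?] [? ? ?]] := xy e'; lia.
- exists (inord 3); rewrite /f inordK //=.
  apply: (deletable_of_flow kc _ zc); last by rewrite normr0 addr0.
    by move=> v; rewrite divB divZ yc xc.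
  by move=> e'; have [[? ? ?] [? ? ?]] := xy e'; lia.
Qed.

End Flows.

Theorem theorem1 (V E : finType) (ends : E -> V * V) :
  k_edge_connected ends 3 -> frank_number_le ends 4.
Proof.
move=> kc; have [x [y [y' [xc yc y'c xy]]]] := three_flows kc.
exact: frank_number_of_flows kc xc yc y'c xy.
Qed.
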